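(* Let $(\mathcal K,\leqslant)$ be a smooth class of finite $\mathfrak L$-structures (for a finite relational language $\mathfrak L$) having the hereditary property and the $\leqslant$-amalgamation property, let $\mathbf M$ be the $(\mathcal K,\leqslant)$-generic structure, with universe $\mathbb N$, and let $G=\mathrm{Aut}(\mathbf M)$ with the topology of pointwise convergence. Then the following are equivalent: (1) $G$ is extremely amenable; (2) (a) $G$ preserves a linear ordering on $\mathbf M$, and (b) $(\mathcal K,\leqslant)$ has the $\leqslant$-Ramsey property.
   Context: A smooth class $(\mathcal K,\leqslant)$: $\mathcal K$ is a class of finite $\mathfrak L$-structures, closed under isomorphism and substructures, containing the empty structure; $\leqslant$ is a reflexive, transitive relation between pairs $A\subseteq B$ of members of $\mathcal K$, invariant under $\mathfrak L$-embeddings, such that (i) $\emptyset\leqslant A$ for all $A\in\mathcal K$; (ii) if $A\subseteq B'\subseteq B$ and $A\leqslant B$ then $A\leqslant B'$; (iii) if $A_1,A_2\subseteq A\in\mathcal K$ and $A_1\leqslant A$ then $A_1\cap A_2\leqslant A_2$. For an infinite structure $N$ and finite $A\subseteq N$, $A\leqslant N$ means $A\leqslant B$ for every finite substructure $B$ of $N$ containing $A$. A $\leqslant$-embedding of $A$ into a structure $N$ is an embedding $\Gamma$ with $\Gamma[A]\leqslant N$; $\binom{N}{A}$ denotes the set of all $\leqslant$-embeddings of $A$ into $N$. Hereditary property: $B\subseteq A\in\mathcal K$ implies $B\in\mathcal K$. $\leqslant$-amalgamation property: for all $A,B,C\in\mathcal K$ and $\leqslant$-embeddings $\gamma_1:A\to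 B$, $\gamma_2:A\to C$ there are $D\in\mathcal K$ and $\leqslant$-embeddings $\lambda_1:B\to D$, $\lambda_2:C\to D$ with $\lambda_1\circ\gamma_1=\lambda_2\circ\gamma_2$. The $(\mathcal K,\leqslant)$-generic structure is the (unique up to isomorphism) countable structure $\mathbf M$ such that $\mathrm{Age}(\mathbf M)=\mathcal K$ (up to isomorphism), $\mathbf M=\bigcup_{i<\omega}A_i$ with $A_i\in\mathcal K$ and $A_i\leqslant A_{i+1}$, and whenever $A\leqslant\mathbf M$ is finite and $A\leqslant B\in\mathcal K$ there is an embedding $\Gamma:B\to\mathbf M$ with $\Gamma\restriction A=\mathrm{id}_A$ and $\Gamma[B]\leqslant\mathbf M$. A topological group $G$ is extremely amenable if every continuous action of $G$ on a compact Hausdorff space has a fixed point. $G$ preserves a linear ordering $\preceq$ on $\mathbf M$ if $a\preceq b$ implies $g(a)\preceq g(b)$ for all $a,b\in\mathbf M$, $g\in G$. For $A\leqslant B\leqslant C$ in $\mathcal K$ and $k\geq1$, write $C\to(B)^A_k$ if for every map $c:\binom{C}{A}\to\{0,\dots,k-1\}$ there is $\lambda\in\binom{C}{B}$ such that $c(\lambda\circ\gamma)$ takes the same value for all $\gamma\in\binom{B}{A}$. $(\mathcal K,\leqslant)$ has the $\leqslant$-Ramsey property if for all $A\leqslant B$ in $\mathcal K$ and all $k\geq2$ there is $C\in\mathcal K$ with $B\leqslant C$ and $C\to(B)^A_k$. *)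

(* Defs.v *)
From HB Require Import structures.
From mathcomp Require Import all_boot all_order all_algebra.
From mathcomp Require Import all_classical all_reals topology.

Set Implicit Arguments.
Unset Strict Implicit.
Unset Printing Implicit Defensive.

Local Open Scope classical_set_scope.

Record language := Language {
  symbol :> finType;
  arity : symbol -> nat;
  (* rules out nullary symbols, so that there is only one empty structure *)
  arity_gt0 : forall R, (0 < arity R)%N
}.

Definition interpretation (L : language) (T : Type) : Type :=
  forall R : L, (arity R).-tuple T -> Prop.

Record structure (L : language) := Structure {
  universe :> Type;
  interp : interpretation L universe
}.
Arguments Structure {L universe} interp.
Arguments interp {L} s R _.

Definition finite_structure (L : language) (A : structure L) : Prop :=
  finite_set [set: A].

Definition empty_structure (L : language) : structure L :=
  Structure (fun (R : L) (_ : (arity R).-tuple void) => False).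

Definition substructure (L : language) (N : structure L) (S : set N) :
    structure L :=
  Structure (fun (R : L) (t : (arity R).-tuple S) =>
    interp N R (map_tuple set_val t)).

Definition embedding (L : language) (A B : structure L) (f : A -> B) : Prop :=
  injective f /\
  forall (R : L) (t : (arity R).-tuple A),
    interp A R t <-> interp B R (map_tuple f t).

Definition isomorphic (L : language) (A B : structure L) : Prop :=
  exists f : A -> B, bijective f /\ embedding f.

(* A relation [A <= B] between finite structures with A included in B: the
   larger structure comes first, and the smaller one is the substructure
   induced on a subset of its universe. *)
Definition strong_rel (L : language) : Type :=
  forall B : structure L, set B -> Prop.

(* [S <= T] for two sets of points of N, viewed as substructures of N *)
Definition strong_in (L : language) (le : strong_rel L) (N : structure L)
    (S T : set N) : Prop :=
  S `<=` T /\ le (substructure T) (set_val @^-1` S).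

Definition hereditary (L : language) (K : structure L -> Prop) : Prop :=
  forall (A : structure L) (S : set A), K A -> K (substructure S).

Record smooth_class (L : language) (K : structure L -> Prop)
    (le : strong_rel L) : Prop := SmoothClass {
  smooth_finite : forall A, K A -> finite_structure A;
  smooth_iso : forall A B, isomorphic A B -> K A -> K B;
  smooth_sub : hereditary K;
  smooth_empty : K (empty_structure L);
  smooth_le_in : forall (B : structure L) (S : set B), le B S -> K B;
  smooth_refl : forall A, K A -> le A setT;
  smooth_trans : forall (C : structure L) (A B : set C),
    strong_in le A B -> le C B -> le C A;
  smooth_invariant : forall (B N : structure L) (f : B -> N) (A : set B),
    K B -> embedding f -> le B A <-> strong_in le (f @` A) (range f);
  smooth_set0 : forall A, K A -> le A set0;
  smooth_mid : forall (B : structure L) (A B' : set B),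
    A `<=` B' -> le B A -> strong_in le A B';
  smooth_cap : forall (A : structure L) (A1 A2 : set A),
    le A A1 -> strong_in le (A1 `&` A2) A2
}.

(* [A <= N] for A a finite subset of an infinite structure N *)
Definition strong_inf (L : language) (le : strong_rel L) (N : structure L)
    (A : set N) : Prop :=
  finite_set A /\
  forall B : set N, finite_set B -> A `<=` B -> strong_in le A B.

Definition strong_embedding (L : language) (le : strong_rel L)
    (A B : structure L) (f : A -> B) : Prop :=
  embedding f /\ le B (range f).

Definition strong_amalgamation (L : language) (K : structure L -> Prop)
    (le : strong_rel L) : Prop :=
  forall (A B C : structure L) (g1 : A -> B) (g2 : A -> C),
    K A -> K B -> K C -> strong_embedding le g1 -> strong_embedding le g2 ->
  exists (D : structure L) (l1 : B -> D) (l2 : C -> D),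
    [/\ K D, strong_embedding le l1, strong_embedding le l2 &
        l1 \o g1 = l2 \o g2].

Definition age (L : language) (N A : structure L) : Prop :=
  finite_structure A /\ exists f : A -> N, embedding f.

(* In the extension clause, an extension [A <= B] of a substructure A of M is
   a strong embedding of A into B. *)
Record generic (L : language) (K : structure L -> Prop) (le : strong_rel L)
    (M : structure L) : Prop := Generic {
  generic_countable : countable [set: M];
  generic_age : forall A, age M A <-> K A;
  generic_union : exists A : nat -> set M,
    [/\ forall i, K (substructure (A i)),
        forall i, strong_in le (A i) (A i.+1) &
        \bigcup_i A i = setT];
  generic_extension : forall (A : set M) (B : structure L)
      (j : substructure A -> B),
    strong_inf le A -> K B -> strong_embedding le j ->
    exists g : B -> M,
      [/\ embedding g, g \o j = set_val & strong_inf le (range g)]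
}.

(* A colouring is a total function on maps A -> C; only its values at strong
   embeddings matter. *)
Definition arrow (L : language) (le : strong_rel L) (C B A : structure L)
    (k : nat) : Prop :=
  forall c : (A -> C) -> 'I_k,
  exists l : B -> C, strong_embedding le l /\
    forall g g' : A -> B, strong_embedding le g -> strong_embedding le g' ->
      c (l \o g) = c (l \o g').

(* [B <= C] is rendered by a strong embedding of B into C. *)
Definition strong_ramsey (L : language) (K : structure L -> Prop)
    (le : strong_rel L) : Prop :=
  forall (B : structure L) (A : set B) (k : nat),
    K B -> le B A -> (2 <= k)%N ->
  exists C : structure L,
    [/\ K C, exists i : B -> C, strong_embedding le i &
        arrow le C B (substructure A) k].

HB.mixin Record isTopologicalGroup G of Topological G & Group G := {
  mulg_continuous : continuous (fun p : G * G => (p.1 * p.2)%g);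
  invg_continuous : continuous (fun x : G => x^-1%g)
}.

#[short(type="topologicalGroupType")]
HB.structure Definition TopologicalGroup :=
  {G of Topological G & Group G & isTopologicalGroup G}.

Definition is_action (G : groupType) (X : Type) (act : G -> X -> X) : Prop :=
  (forall x, act 1%g x = x) /\
  forall g h x, act (g * h)%g x = act g (act h x).

Definition extremely_amenable (G : topologicalGroupType) : Prop :=
  forall (X : topologicalType) (act : G -> X -> X),
    [set: X] !=set0 -> compact [set: X] -> hausdorff_space X ->
    is_action act -> continuous (fun p : G * X => act p.1 p.2) ->
  exists x : X, forall g : G, act g x = x.

(* The topology on nat is discrete, so that [{ptws nat -> nat}] carries the
   topology of pointwise convergence; [aut M] gets the subspace topology. *)
Definition automorphism (L : language) (M : interpretation L nat) :
    set {ptws nat -> nat} :=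
  [set g | bijective g /\ @embedding L (Structure M) (Structure M) g].

Definition aut (L : language) (M : interpretation L nat) : Type :=
  set_type (automorphism M).

HB.instance Definition _ (L : language) (M : interpretation L nat) :=
  Topological.copy (aut M) (set_type (automorphism M)).

Definition aut_fun (L : language) (M : interpretation L nat) (g : aut M) :
  nat -> nat := set_val g.
Coercion aut_fun : aut >-> Funclass.

Lemma autP (L : language) (M : interpretation L nat) (g : aut M) :
  automorphism M g.
Proof. exact: set_valP. Qed.

Lemma aut_ext (L : language) (M : interpretation L nat) (g h : aut M) :
  (g : nat -> nat) =1 h -> g = h.
Proof. by move=> gh; apply: val_inj; apply: funext. Qed.

Definition mk_aut (L : language) (M : interpretation L nat) (g : nat -> nat)
  (Hg : automorphism M g) : aut M := SigSub (mem_set Hg).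

Lemma map_tuple_comp (n : nat) (S T U : Type) (f : T -> U) (g : S -> T)
    (t : n.-tuple S) : map_tuple (f \o g) t = map_tuple f (map_tuple g t).
Proof. by apply: val_inj; rewrite /= map_comp. Qed.

Lemma map_tuple_eq_id (n : nat) (T : Type) (f : T -> T) (t : n.-tuple T) :
  f =1 id -> map_tuple f t = t.
Proof. by move=> fid; apply: val_inj; rewrite /= (eq_map fid) map_id. Qed.

Lemma automorphism_id (L : language) (M : interpretation L nat) :
  automorphism M idfun.
Proof.
split; first by exists idfun.
by split=> // R t; rewrite map_tuple_eq_id.
Qed.

Lemma automorphism_comp (L : language) (M : interpretation L nat)
    (g h : nat -> nat) :
  automorphism M g -> automorphism M h -> automorphism M (g \o h).
Proof.
move=> [bg [ig eg]] [bh [ih eh]]; split; first exact: bij_comp.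
split; first exact: inj_comp.
by move=> R t; rewrite map_tuple_comp -eg -eh.
Qed.

Lemma automorphism_inv (L : language) (M : interpretation L nat) (g : aut M) :
  exists h : aut M, cancel g h /\ cancel h g.
Proof.
have [[f gf fg] [_ eg]] := autP g.
suff Hf : automorphism M f by exists (mk_aut Hf).
split; first by exists (g : nat -> nat).
split; first exact: can_inj fg.
move=> R t; rewrite (eg R (map_tuple f t)) -map_tuple_comp.
by rewrite map_tuple_eq_id.
Qed.

Definition aut_one (L : language) (M : interpretation L nat) : aut M :=
  mk_aut (automorphism_id M).

Definition aut_mul (L : language) (M : interpretation L nat) (g h : aut M) :
  aut M := mk_aut (automorphism_comp (autP g) (autP h)).

Definition aut_inv (L : language) (M : interpretation L nat) (g : aut M) :
  aut M := sval (cid (automorphism_inv g)).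

Lemma aut_invK (L : language) (M : interpretation L nat) (g : aut M) :
  cancel g (aut_inv g).
Proof. by rewrite /aut_inv; case: cid => h []. Qed.

Lemma aut_invKV (L : language) (M : interpretation L nat) (g : aut M) :
  cancel (aut_inv g) g.
Proof. by rewrite /aut_inv; case: cid => h []. Qed.

Lemma aut_mulA (L : language) (M : interpretation L nat) :
  associative (@aut_mul L M).
Proof. by move=> f g h; exact: aut_ext. Qed.

Lemma aut_mul1g (L : language) (M : interpretation L nat) :
  left_id (aut_one M) (@aut_mul L M).
Proof. by move=> g; exact: aut_ext. Qed.

Lemma aut_mulg1 (L : language) (M : interpretation L nat) :
  right_id (aut_one M) (@aut_mul L M).
Proof. by move=> g; exact: aut_ext. Qed.

Lemma aut_mulVg (L : language) (M : interpretation L nat) :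
  left_inverse (aut_one M) (@aut_inv L M) (@aut_mul L M).
Proof. by move=> g; apply: aut_ext => n; exact: aut_invK. Qed.

Lemma aut_mulgV (L : language) (M : interpretation L nat) :
  right_inverse (aut_one M) (@aut_inv L M) (@aut_mul L M).
Proof. by move=> g; apply: aut_ext => n; exact: aut_invKV. Qed.

HB.instance Definition _ (L : language) (M : interpretation L nat) :=
  isGroup.Build (aut M) (@aut_mulA L M) (@aut_mul1g L M) (@aut_mulg1 L M)
    (@aut_mulVg L M) (@aut_mulgV L M).

Lemma near_aut (L : language) (M : interpretation L nat) (g : aut M) (n : nat) :
  nbhs g [set h : aut M | h n = g n].
Proof.
have c1 : continuous (set_val : aut M -> {ptws nat -> nat}).
  exact: initial_continuous.
have c2 : continuous (fun f : {ptws nat -> nat} => f n).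
  exact: (@proj_continuous nat (fun=> nat)).
have nn : nbhs (g n) [set g n].
  by rewrite nbhs_principalE; exact/principal_filterP.
exact: (c1 g) _ (c2 (set_val g) _ nn).
Qed.

Lemma cvg_aut (L : language) (M : interpretation L nat) (Y : topologicalType)
    (f : Y -> aut M) (y : Y) :
  (forall n, nbhs y [set z | f z n = f y n]) -> f z @[z --> y] --> f y.
Proof.
move=> H.
pose F : set_system {ptws nat -> nat} := (fun z => set_val (f z)) @ y.
have c : {ptws, F --> set_val (f y)}.
  apply/pointwise_cvgP => n A; rewrite nbhs_principalE => /principal_filterP An.
  by apply: filterS (H n) => z fz; rewrite /= (_ : set_val _ n = f y n).
move=> A [_ [[B oB <-] /= By BA]].
have : nbhs (set_val (f y) : {ptws nat -> nat}) B by apply: open_nbhs_nbhs.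
move=> /c FB; apply: (@filterS _ (nbhs y) _ _ _ _ FB) => z Bz; exact: BA.
Qed.

Lemma aut_mul_continuous (L : language) (M : interpretation L nat) :
  continuous (fun p : aut M * aut M => (p.1 * p.2)%g).
Proof.
move=> [g h]; apply: cvg_aut => n /=.
exists ([set g' : aut M | g' (aut_fun h n) = aut_fun g (aut_fun h n)],
        [set h' : aut M | h' n = aut_fun h n]) => /=.
  by split; exact: near_aut.
by move=> [g' h'] /= [Hg Hh]; rewrite -[RHS]Hg -Hh.
Qed.

Lemma aut_inv_continuous (L : language) (M : interpretation L nat) :
  continuous (fun g : aut M => g^-1%g).
Proof.
move=> g; apply: cvg_aut => n.
apply: filterS (near_aut g (aut_inv g n)) => h.
by rewrite aut_invKV => hn; rewrite -{1}hn; exact: aut_invK.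
Qed.

HB.instance Definition _ (L : language) (M : interpretation L nat) :=
  isTopologicalGroup.Build (aut M) (@aut_mul_continuous L M)
    (@aut_inv_continuous L M).

Definition preserves_linear_order (L : language) (M : interpretation L nat) :
    Prop :=
  exists r : rel nat,
    [/\ reflexive r, antisymmetric r, transitive r & total r] /\
    forall (g : aut M) (a b : nat), r a b -> r (g a) (g b).

(* Main.v *)
Require Import Defs.
From HB Require Import structures.
From mathcomp Require Import all_boot all_order all_algebra.
From mathcomp Require Import all_classical all_reals topology.

(* Extreme amenability gives (a) and (b) by the same device: a closed
   Aut(M)-invariant nonempty set of colourings of a discrete set with open
   stabilisers is a compact space with a fixed point. For (a) the colourings are
   the linear orders of M. For (b), if no finite C satisfies C -> (B)^A_k, then by
   compactness some k-colouring of the strong embeddings of A into M is constant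
   on no copy of B; an invariant colouring of this kind cannot exist, as Aut(M) is
   transitive on strong embeddings by back and forth.

   Conversely, if Aut(M) acts on a compact Hausdorff space X without fixed points,
   finitely many open sets U_y with U_y and g_y U_y disjoint cover X robustly
   enough that h |-> (some y with h^-1 x0 in U_y) may be chosen to depend only on
   the restriction of h to a finite strong A. The Ramsey property for A and a
   strong B containing A and all g_y^-1 A yields an h for which h and
   h g_y^-1 have the same colour y, so that h^-1 x0 and g_y h^-1 x0 both lie in
   U_y. *)

Set Implicit Arguments.
Unset Strict Implicit.
Unset Printing Implicit Defensive.

Local Open Scope classical_set_scope.

(** * Embeddings and restriction of codomains *)

Section Embeddings.
Context {L : language}.
Implicit Types A B C N : structure L.

Lemma embedding_comp A B C (f : A -> B) (g : B -> C) :
  embedding f -> embedding g -> embedding (g \o f).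
Proof.
move=> [fi fR] [gi gR]; split; first exact: inj_comp.
by move=> R t; rewrite map_tuple_comp -gR -fR.
Qed.

Lemma embedding_val N (S : set N) : embedding (set_val : substructure S -> N).
Proof. by split; first exact: val_inj. Qed.

Lemma range_set_val N (S : set N) :
  range (set_val : substructure S -> N) = S.
Proof.
apply/seteqP; split=> [_ [x _ <-]|x Sx]; first exact: set_valP.
by exists (SigSub (mem_set Sx)).
Qed.

Lemma embedding_factor A B C (f : A -> B) (g : B -> C) :
  embedding g -> embedding (g \o f) -> embedding f.
Proof.
move=> [_ gR] [gfi gfR]; split=> [x y fxy|R t].
  by apply: gfi; rewrite /= fxy.
by rewrite gfR map_tuple_comp -gR.
Qed.

Definition corestrict A N (S : set N) (f : A -> N) (fS : forall a, S (f a)) :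
  A -> substructure S := fun a => SigSub (mem_set (fS a)).

Lemma embedding_corestrict A N (S : set N) (f : A -> N)
  (fS : forall a, S (f a)) : embedding f -> embedding (corestrict fS).
Proof. by move=> ef; apply: embedding_factor (embedding_val S) _. Qed.

Lemma range_corestrict A N (S : set N) (f : A -> N) (fS : forall a, S (f a)) :
  range (corestrict fS) = set_val @^-1` range f.
Proof.
apply/seteqP; split=> [_ [a _ <-]|x [a _ fa]]; first by exists a.
by exists a => //; apply: val_inj.
Qed.

End Embeddings.

(** * Transfer of strong subsets along embeddings *)

Section SmoothClass.
Context {L : language} {K : structure L -> Prop} {le : strong_rel L}.
Arguments le : clear implicits.
Hypothesis smooth : smooth_class K le.
Implicit Types A B C N : structure L.

Lemma le_image B N (f : B -> N) (S : set B) :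
  strong_embedding le f -> le B S -> le N (f @` S).
Proof.
move=> [ef lef] leS; apply: (smooth_trans smooth) lef.
exact: (smooth_invariant smooth _ (smooth_le_in smooth leS) ef).1.
Qed.

Lemma le_preimage B N (f : B -> N) (S : set B) :
  K B -> embedding f -> le N (f @` S) -> le B S.
Proof.
move=> KB ef leS; apply/(smooth_invariant smooth _ KB ef).
by apply: (smooth_mid smooth) leS => _ [x _ <-]; exists x.
Qed.

Lemma strong_embedding_comp A B C (f : A -> B) (g : B -> C) :
  strong_embedding le f -> strong_embedding le g ->
  strong_embedding le (g \o f).
Proof.
move=> [ef lef] sg; split; first exact: embedding_comp sg.1.
by rewrite -(image_comp f g); exact: le_image.
Qed.

End SmoothClass.

(** Both types are coded injectively by ordinals, and a function is determined by its coded graph, a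
    finite set of pairs. *)
Lemma finite_set_fun (T U : Type) :
  finite_set [set: T] -> finite_set [set: U] -> finite_set [set: T -> U].
Proof.
have code (V : Type) : finite_set [set: V] ->
    exists (n : nat) (h : V -> 'I_n.+1), injective h.
  move=> [n /pcard_eqP[h]]; exists n, (fun v => inord (h v)) => x y hxy.
  have hn (z : V) : (h z < n.+1)%N.
    by rewrite ltnS ltnW //; have := @funS _ _ _ _ h z I.
  apply: (@inj _ _ _ h); rewrite ?in_setT //.
  by have /(congr1 (@nat_of_ord _)) := hxy; rewrite !inordK.
move=> /code[n [h hi]] /code[m [k ki]].
pose graph (f : T -> U) : {set 'I_n.+1 * 'I_m.+1} :=
  [set p | `[< exists a, p = (h a, k (f a)) >]]%SET.
rewrite -(preimage_setT graph); apply: finite_preimage; last first.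
  exact: finite_finset.
move=> f g _ _ fg; apply/funext => a; apply: ki.
have : (h a, k (f a)) \in graph f by rewrite inE; apply/asboolP; exists a.
by rewrite fg inE => /asboolP[b [/hi <- ->]].
Qed.

(** * The generic structure: strong sets, extension and homogeneity *)

Section Generic.
Context {L : language} {K : structure L -> Prop} {le : strong_rel L}.
Arguments le : clear implicits.
Context {M : interpretation L nat}.
Hypothesis smooth : smooth_class K le.
Hypothesis M_generic : generic K le (Structure M).
Local Notation MM := (Structure M).
Implicit Types A B C : structure L.

Lemma finite_substructure_in (S : set MM) : finite_set S -> K (substructure S).
Proof.
move=> fS; apply/(generic_age M_generic); split; last first.
  by exists set_val; exact: embedding_val.
rewrite /finite_structure -(_ : set_val @^-1` S = [set: S]).
  by apply: finite_preimage fS => x y _ _; exact: val_inj.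
by apply/seteqP; split=> // x _; exact: set_valP.
Qed.

Lemma finite_range A (f : A -> MM) : K A -> finite_set (range f).
Proof. by move=> /(smooth_finite smooth)/finite_image. Qed.

Lemma strong_in_sub (S D D' : set MM) : finite_set D' ->
  strong_in le S D' -> S `<=` D -> D `<=` D' -> strong_in le S D.
Proof.
move=> fD' [_ leS] SD DD'; split=> //.
have KD := finite_substructure_in (sub_finite_set DD' fD').
have vD' (x : substructure D) : D' (set_val x) by apply: DD'; exact: set_valP.
apply: (@le_preimage _ _ _ smooth _ _ (corestrict vD')) => //.
  exact: embedding_corestrict (embedding_val D).
rewrite (_ : _ @` _ = set_val @^-1` S) //.
apply/seteqP; split=> [_ [x Sx <-]//|x /= Sx].
by exists (SigSub (mem_set (SD _ Sx))) => //; apply: val_inj.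
Qed.

(** A finite set lies in some member [A n] of the chain from [generic_union]. Transitivity makes
    [A n] strong in all later members, and each finite superset of [A n] sits inside one of them. *)
Lemma ex_strong_superset (S : set MM) : finite_set S ->
  exists2 D, strong_inf le D & S `<=` D.
Proof.
move=> fS; have [A [KA sA UA]] := generic_union M_generic.
have fA i : finite_set (A i).
  by rewrite -(range_set_val (A i)); exact: finite_range.
have AS i j : (i <= j)%N -> A i `<=` A j.
  elim: j => [|j IH]; first by rewrite leqn0 => /eqP->.
  rewrite leq_eqVlt => /predU1P[->//|]; rewrite ltnS => /IH ij x /ij.
  by apply: (sA j).1.
have ex_i (D : set MM) : finite_set D -> exists n, D `<=` A n.
  move=> /finite_seqP[s ->].
  have /choice[n nP] : forall x, exists n, A n x.
    by move=> x; have : setT x by []; rewrite -UA => -[n]; exists n.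
  exists (\max_(x <- s) n x) => x /= xs.
  by apply: AS (nP x); rewrite (big_rem x) //= leq_maxl.
have sAij i j : (i <= j)%N -> strong_in le (A i) (A j).
  move=> /subnKC <-; elim: (j - i)%N => [|d IH].
    rewrite addn0; split=> //; rewrite (_ : _ @^-1` _ = setT).
      exact: (smooth_refl smooth (KA i)).
    by apply/seteqP; split=> // x _; exact: set_valP.
  rewrite addnS; have [sub leS] := sA (i + d)%N.
  split; first by apply: AS; rewrite -addnS leq_addr.
  have vA (x : substructure (A (i + d)%N)) : A (i + d).+1 (set_val x).
    by apply: sub; exact: set_valP.
  rewrite (_ : _ @^-1` _ = corestrict vA @` (set_val @^-1` A i)).
    apply: (@le_image _ _ _ smooth _ _ (corestrict vA)); last exact: IH.2.
    split; first exact: embedding_corestrict (embedding_val _).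
    by rewrite range_corestrict range_set_val.
  apply/seteqP; split=> [x Ax|_ [x Ax <-] //].
  by exists (SigSub (mem_set (IH.1 _ Ax))) => //; apply: val_inj.
have [n Sn] := ex_i S fS; exists (A n) => //; split=> // B fB AB.
have [m Bm] := ex_i B fB.
apply: (@strong_in_sub _ _ (A (maxn n m))) => //.
- by apply: sAij; rewrite leq_maxl.
- by apply: subset_trans Bm _; apply: AS; rewrite leq_maxr.
Qed.

(* [strong_embedding] does not apply to maps into M, because [le] only relates
   finite structures. *)
Definition generic_embedding A (f : A -> MM) : Prop :=
  embedding f /\ strong_inf le (range f).

Lemma generic_embedding_corestrict A (f : A -> MM) (D : set MM)
    (fD : forall a, D (f a)) :
  finite_set D -> generic_embedding f -> strong_embedding le (corestrict fD).
Proof.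
move=> finD [ef [_ sf]]; split; first exact: embedding_corestrict.
rewrite range_corestrict; apply: (sf D finD _).2.
by move=> _ [a _ <-].
Qed.

Lemma generic_embedding_comp A B (f : A -> B) (g : B -> MM) :
  strong_embedding le f -> generic_embedding g -> generic_embedding (g \o f).
Proof.
move=> sf gg; split; first exact: embedding_comp sf.1 gg.1.
have [eg [fg sg]] := gg.
have gf : range (g \o f) `<=` range g by move=> _ [a _ <-]; exists (f a).
split=> [|D fD gfD]; first exact: sub_finite_set fg.
(* [D] need not contain [range g]. In the union, [f] and [g] compose as strong embeddings of finite
   structures, and strength passes down to [D]. *)
have fU : finite_set (D `|` range g) by rewrite finite_setU.
apply: (@strong_in_sub _ _ (D `|` range g)) => //.
split; first by apply: subset_trans gf _ => x; right.
have gU b : (D `|` range g) (g b) by right; exists b.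
rewrite -(range_corestrict (fun a => gU (f a))).
exact: (strong_embedding_comp smooth sf
  (generic_embedding_corestrict gU fU gg)).2.
Qed.

Lemma generic_embedding_val (D : set MM) : strong_inf le D ->
  generic_embedding (set_val : substructure D -> MM).
Proof.
by move=> sD; split; [exact: embedding_val|rewrite range_set_val].
Qed.

(** [generic_extension] starts from a strong subset of M, so it is applied to [i] composed with the
    inverse [e'] of [e] on its range. *)
Lemma generic_embedding_extend A B (e : A -> MM) (i : A -> B) :
  generic_embedding e -> strong_embedding le i ->
  exists2 g : B -> MM, generic_embedding g & g \o i = e.
Proof.
move=> [ee se] si; have KB := smooth_le_in smooth si.2.
have /choice[e' e'P] : forall y : substructure (range e),
    exists a, e a = set_val y.
  by move=> y; have [a _ ya] := set_valP y; exists a.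
have e'e (a : A) (ea : range e (e a)) : e' (SigSub (mem_set ea)) = a.
  by apply: ee.1; rewrite e'P.
have ee' : embedding e'.
  apply: (embedding_factor ee); rewrite (_ : e \o e' = set_val).
    exact: embedding_val.
  exact/funext.
have [|g [eg gi sg]] := generic_extension M_generic (j := i \o e') se KB.
  split; first exact: embedding_comp si.1.
  rewrite (_ : range _ = range i); first exact: si.2.
  apply/seteqP; split=> [_ [y _ <-]|_ [a _ <-]]; first by exists (e' y).
  have ea : range e (e a) by exists a.
  by exists (SigSub (mem_set ea)) => //=; rewrite e'e.
exists g => //; apply/funext => a /=.
have ea : range e (e a) by exists a.
have /(congr1 (fun f => f (SigSub (mem_set ea)))) := gi.
by rewrite /= e'e.
Qed.

Lemma ex_generic_embedding B : K B -> exists g : B -> MM, generic_embedding g.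
Proof.
move=> KB.
have s0 : strong_inf le (set0 : set MM).
  split=> [|D fD _]; first exact: finite_set0.
  by split=> //; rewrite preimage_set0;
    exact: (smooth_set0 smooth (finite_substructure_in fD)).
have no (x : substructure (set0 : set MM)) : False := set_valP x.
pose i : substructure (set0 : set MM) -> B := fun x => match no x with end.
have si : strong_embedding le i.
  split.
    split=> [x|R t]; first by case: (no x).
    (* Arities are positive, so a tuple over the empty set would have a first entry. *)
    by case: (no (tnth t (Ordinal (arity_gt0 R)))).
  rewrite (_ : range i = set0); first exact: (smooth_set0 smooth KB).
  by apply/seteqP; split=> // ? [x]; case: (no x).
by have [g gg _] := generic_embedding_extend (generic_embedding_val s0) si;
  exists g.
Qed.

(** For finite [D] containing the image, [g] restricts to an isomorphism from its preimage [D0] onto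
    [D], which carries strength over. *)
Lemma generic_embedding_aut A (f : A -> MM) (g : aut M) :
  generic_embedding f -> generic_embedding ((g : nat -> nat) \o f).
Proof.
move=> gf; have [bg eg] := autP g.
have [ef [ff _]] := gf.
split; first exact: (@embedding_comp _ A MM MM f g).
split; first by rewrite -(image_comp f g); exact: finite_image.
move=> D fD gfD; split=> //; pose D0 : set MM := (g : nat -> nat) @^-1` D.
have fD0 : finite_set D0 by apply: finite_preimage fD => x y _ _; exact: eg.1.
have fA a : D0 (f a) by apply: gfD; exists a.
have vD (x : substructure D0) : D ((g : nat -> nat) (set_val x)).
  exact: (set_valP x).
have sg : strong_embedding le (@corestrict _ (substructure D0) MM D _ vD).
  split.
    apply: embedding_corestrict.
    exact: (@embedding_comp _ (substructure D0) MM MM set_val g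
      (embedding_val D0) eg).
  rewrite (_ : range _ = setT); last first.
    apply/seteqP; split=> // y _.
    have [h gh hg] := bg.
    have Dy : D0 (h (set_val y)) by rewrite /D0 /= hg; exact: set_valP.
    by exists (SigSub (mem_set Dy)) => //; apply: val_inj => /=; rewrite hg.
  exact: (smooth_refl smooth (finite_substructure_in fD)).
have := strong_embedding_comp smooth (generic_embedding_corestrict fA fD0 gf) sg.
move=> [_]; rewrite (_ : range _ = set_val @^-1` range ((g : nat -> nat) \o f)) //.
apply/seteqP; split=> [_ [a _ <-]|x [a _ fx]]; first by exists a.
by exists a => //; apply: val_inj.
Qed.

(** A span of two generic embeddings encodes an isomorphism between finite strong subsets of M; the
    back step is the forth step with the legs swapped. *)
Record partial_iso := PartialIso {
  piso_dom : structure L;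
  piso_l : piso_dom -> MM;
  piso_r : piso_dom -> MM;
  piso_lP : generic_embedding piso_l;
  piso_rP : generic_embedding piso_r
}.

Definition piso_graph (s : partial_iso) : set (nat * nat) :=
  [set p | exists a, p = (piso_l (p := s) a, piso_r a)].

(** Inside a finite strong [D] containing the left range and [n], the left leg is a strong
    embedding, and the right leg extends along it to [D]. *)
Lemma piso_forth (s : partial_iso) (n : nat) :
  exists2 t : partial_iso, piso_graph s `<=` piso_graph t &
    range (piso_l (p := t)) n.
Proof.
have [|D sD SD] := @ex_strong_superset (range (piso_l (p := s)) `|` [set n]).
  by rewrite finite_setU; split; [case: (piso_lP s) => _ []|exact: finite_set1].
have lD a : D (piso_l (p := s) a) by apply: SD; left; exists a.
have [g gg gl] := generic_embedding_extend (piso_rP s)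
  (generic_embedding_corestrict lD sD.1 (piso_lP s)).
exists (PartialIso (generic_embedding_val sD) gg).
  by move=> _ [a ->]; exists (corestrict lD a); rewrite -gl.
have Dn : D n by apply: SD; right.
by exists (SigSub (mem_set Dn)).
Qed.

Lemma piso_back_forth (s : partial_iso) (n : nat) :
  exists t : partial_iso, [/\ piso_graph s `<=` piso_graph t,
    range (piso_l (p := t)) n & range (piso_r (p := t)) n].
Proof.
have [t st tn] := piso_forth s n.
have [u tu un] := piso_forth (PartialIso (piso_rP t) (piso_lP t)) n.
have {}tu : piso_graph t `<=` piso_graph (PartialIso (piso_rP u) (piso_lP u)).
  move=> _ [a ->].
  have /tu[b [r l]] : piso_graph (PartialIso (piso_rP t) (piso_lP t))
      (piso_r (p := t) a, piso_l a) by exists a.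
  by exists b => /=; rewrite r l.
exists (PartialIso (piso_rP u) (piso_lP u)); split=> //.
  by apply: subset_trans tu.
have [a _ <-] := tn; have /tu[b [-> _]] : piso_graph t (piso_l a, piso_r a).
  by exists a.
by exists b.
Qed.

Lemma generic_homogeneous A (e f : A -> MM) :
  generic_embedding e -> generic_embedding f ->
  exists g : aut M, (g : nat -> nat) \o e = f.
Proof.
move=> ge gf.
(* The first component counts stages: stage [n] puts the point [n] into both ranges, so the union
   [G] is total and onto. *)
pose step (x y : nat * partial_iso) := [/\ y.1 = x.1.+1,
  piso_graph x.2 `<=` piso_graph y.2, range (piso_l (p := y.2)) x.1 &
  range (piso_r (p := y.2)) x.1].
have [|s [s0 sS]] := @dependent_choice _ step _ (0%N, PartialIso ge gf).
  move=> [n s]; apply: cid; have [t [st tl tr]] := piso_back_forth s n.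
  by exists (n.+1, t).
have s1 n : (s n).1 = n.
  by elim: n => [|n IH]; [rewrite s0|have [-> _ _ _] := sS n; rewrite IH].
have sle m n : (m <= n)%N -> piso_graph (s m).2 `<=` piso_graph (s n).2.
  elim: n => [|n IH]; first by rewrite leqn0 => /eqP->.
  rewrite leq_eqVlt => /predU1P[->//|]; rewrite ltnS => /IH mn.
  by apply: subset_trans mn _; have [] := sS n.
pose G x y := exists n, piso_graph (s n).2 (x, y).
have G_joint x y x' y' : G x y -> G x' y' ->
    exists n, piso_graph (s n).2 (x, y) /\ piso_graph (s n).2 (x', y').
  move=> [m Gm] [n Gn]; exists (maxn m n).
  by split; [apply: (sle m) Gm|apply: (sle n) Gn]; rewrite ?leq_maxl ?leq_maxr.
have G_fun x y y' : G x y -> G x y' -> y = y'.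
  move=> Gy /(G_joint _ _ _ _ Gy)[n [[a [-> ->]] [b [ab ->]]]].
  by have /(piso_lP _).1.1 -> := ab.
have G_inj x x' y : G x y -> G x' y -> x = x'.
  move=> Gx /(G_joint _ _ _ _ Gx)[n [[a [-> ->]] [b [-> ab]]]].
  by have /(piso_rP _).1.1 -> := ab.
have G_tot x n : (x < n)%N -> exists a : piso_dom (s n).2, piso_l a = x.
  move=> xn; have [_ _] := sS x; rewrite s1 => -[a _ ax] _.
  have /(sle _ _ xn)[b [+ _]] : piso_graph (s x.+1).2 (piso_l a, piso_r a).
    by exists a.
  by rewrite ax; exists b.
have [g gP] : {g : nat -> nat & forall x, G x (g x)}.
  apply: choice => x; have [a <-] := G_tot x x.+1 (leqnn _).
  by exists (piso_r a), x.+1, a.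
have [h hP] : {h : nat -> nat & forall y, G (h y) y}.
  apply: (@choice _ _ (fun y x => G x y)) => y; have [_ _ _] := sS y; rewrite s1 => -[a _ ay].
  by exists (piso_l a), y.+1, a; rewrite ay.
have gK n (a : piso_dom (s n).2) : g (piso_l a) = piso_r a.
  by apply: (G_fun (piso_l a)); [exact: gP|exists n, a].
have autg : automorphism M g.
  have gi : injective g.
    by move=> x y gxy; apply: (G_inj _ _ (g x)); [exact: gP|rewrite gxy; exact: gP].
  split.
    exists h => x; first by apply: (G_inj _ _ (g x)).
    by apply: (G_fun (h x)).
  (* All entries of [t] lie in the left range at stage [n], so the two legs of that one stage
     compare [R] at [t] and at its image. *)
  split=> // R t; pose n := (\max_i tnth t i).+1.
  have [u uP] : {u : 'I_(arity R) -> piso_dom (s n).2 &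
      forall i, piso_l (u i) = tnth t i}.
    apply: (@choice _ _ (fun i a => piso_l a = tnth t i)) => i; apply: G_tot.
    by rewrite ltnS; exact: (leq_bigmax i).
  have tE : t = map_tuple (piso_l (p := (s n).2)) (mktuple u).
    by apply: eq_from_tnth => i; rewrite tnth_map tnth_mktuple uP.
  have gtE : map_tuple g t = map_tuple (piso_r (p := (s n).2)) (mktuple u).
    by apply: eq_from_tnth => i; rewrite tE !tnth_map gK.
  by rewrite gtE tE -(piso_lP _).1.2 -(piso_rP _).1.2.
exists (mk_aut autg); apply/funext => a.
by have := @gK 0%N; rewrite s0; apply.
Qed.
End Generic.

(** * Compact spaces of colourings *)

Section Colourings.
Context {I : choiceType}.
Implicit Types Y : set (I -> nat).

(** This is closedness in the product of discrete spaces, in combinatorial form: a failure to lie in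
    [Y] is visible at finitely many points. *)
Definition finitarily_closed Y : Prop :=
  forall c, ~ Y c ->
  exists s : seq I, forall c' : I -> nat, {in s, c' =1 c} -> ~ Y c'.

Lemma near_ptws_nat (c : {ptws I -> nat}) (i : I) :
  nbhs c [set c' : {ptws I -> nat} | c' i = c i].
Proof.
have nn : nbhs (c i) [set c i].
  by rewrite nbhs_principalE; exact/principal_filterP.
exact: (@proj_continuous I (fun=> nat) i c _ nn).
Qed.

Lemma near_ptws_nat_seq (c : {ptws I -> nat}) (s : seq I) :
  nbhs c [set c' : {ptws I -> nat} | {in s, c' =1 c}].
Proof.
elim: s => [|i s IH]; first by apply: filterS filterT.
apply: filterS (filterI (near_ptws_nat c i) IH) => c' [/= ci cs] j.
by rewrite inE => /predU1P[->|/cs].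
Qed.

Lemma finitarily_closed_ptws Y :
  finitarily_closed Y -> closed (Y : set {ptws I -> nat}).
Proof.
move=> Yc; rewrite -[Y]setCK; apply: open_closedC; rewrite openE => c /Yc[s sP].
by apply: filterS (near_ptws_nat_seq c s) => c' /sP.
Qed.

Lemma compact_colourings (k : nat) :
  compact [set c : {ptws I -> nat} | forall i, (c i < k)%N].
Proof.
apply: (@tychonoff I (fun=> nat) (fun=> `I_k)) => i.
by apply: finite_compact; exact: finite_II.
Qed.

Lemma ex_nested_colouring (k : nat) (Y : nat -> set (I -> nat)) :
  (forall n, finitarily_closed (Y n)) ->
  (forall n c, Y n c -> forall i, (c i < k)%N) ->
  (forall n, Y n.+1 `<=` Y n) -> (forall n, Y n !=set0) ->
  exists c, forall n, Y n c.
Proof.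
move=> Ycl Yk YS Yn0.
have Yle m n : (m <= n)%N -> Y n `<=` Y m.
  elim: n => [|n IH]; first by rewrite leqn0 => /eqP->.
  rewrite leq_eqVlt => /predU1P[->//|]; rewrite ltnS => /IH mn.
  exact: subset_trans (YS n) mn.
(* The [Y n] generate a proper filter on the compact space of [k]-colourings; a cluster point lies
   in each [Y n], as these are closed. *)
pose F : set_system {ptws I -> nat} := filter_from setT Y.
have FF : ProperFilter F.
  apply: filter_from_proper => [|n _]; last exact: Yn0.
  apply: filter_from_filter; first by exists 0%N.
  move=> m n _ _; exists (maxn m n) => // c Yc.
  by split; apply: Yle Yc; rewrite ?leq_maxl ?leq_maxr.
have [|c [_ cF]] := @compact_colourings k F FF.
  by exists 0%N => // c; exact: Yk.
exists c => n; apply: (finitarily_closed_ptws (Ycl n)) => B /cF cB.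
by apply: cB; exists n.
Qed.

End Colourings.

(** * Compact Hausdorff subspaces and invariant colourings *)

Lemma compact_set_type (X : topologicalType) (Y : set X) :
  compact Y -> compact [set: set_type Y].
Proof.
move=> cY F FF _.
have [|y [Yy yF]] := cY (set_val @ F) (fmap_proper_filter _ FF).
  rewrite nbhs_simpl /= (_ : _ @^-1` _ = setT); first exact: filterT.
  by apply/seteqP; split=> // x _; exact: (set_valP x).
exists (SigSub (mem_set Yy)); split=> // S B FS [_ [[U oU <-] /= Uy UB]].
have [|_ [[x Sx <-] Ux]] := yF (set_val @` S) U _ (open_nbhs_nbhs (conj oU Uy)).
  by apply: (@filterS _ F _ _ _ _ FS) => x Sx; exists x.
by exists x; split=> //; exact: UB.
Qed.

Lemma hausdorff_set_type (X : topologicalType) (Y : set X) :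
  hausdorff_space X -> hausdorff_space (set_type Y).
Proof.
move=> hX x y xy; apply: val_inj; apply: hX => A B Ax By.
have c : continuous (set_val : set_type Y -> X) by exact: initial_continuous.
by have [z [Az Bz]] := xy _ _ (c x _ Ax) (c y _ By); exists (set_val z).
Qed.

(* An invariant closed set of colourings is a compact Hausdorff G-space; the
   action on it is continuous because the stabilisers in [I] are open. *)
Lemma ex_invariant_colouring (G : topologicalGroupType) (I : choiceType)
    (act : G -> I -> I) (k : nat) (Y : set (I -> nat)) :
  extremely_amenable G -> is_action act ->
  (forall g i, nbhs g [set h | act h i = act g i]) ->
  finitarily_closed Y -> (forall c, Y c -> forall i, (c i < k)%N) ->
  (forall c g, Y c -> Y (c \o act g)) -> Y !=set0 ->
  exists2 c, Y c & forall g, c \o act g = c.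
Proof.
move=> EA [act1 actM] act_open Ycl Yk Yinv [c0 Yc0].
pose X := set_type (Y : set {ptws I -> nat}).
(* Precomposing with the inverse of [g] makes this a left action. *)
pose actX (g : G) (c : X) : X :=
  SigSub (mem_set (Yinv (set_val c) g^-1%g (set_valP c))).
have valX g c i : (set_val (actX g c) : I -> nat) i = set_val c (act g^-1%g i).
  by [].
have [|||||c cfix] := EA X actX.
- by exists (SigSub (mem_set Yc0)).
- apply: compact_set_type.
  have cY := finitarily_closed_ptws Ycl.
  by apply: (subclosed_compact cY (@compact_colourings I k)) => c /Yk.
- apply: hausdorff_set_type; apply: (@hausdorff_product I (fun=> nat)) => _.
  exact: discrete_hausdorff.
- split=> [c|g h c]; apply: val_inj; apply/funext => i; rewrite /=.
    by rewrite invg1 act1.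
  by rewrite invgM actM.
- move=> [g c] A [_ [[B oB <-] /= By BA]].
  have nB : nbhs (set_val (actX g c)) B by exact: open_nbhs_nbhs.
  pose F : set_system {ptws I -> nat} :=
    (fun p : G * X => set_val (actX p.1 p.2)) @ (g, c).
  suff cF : F --> set_val (actX g c).
    have /cF FB := nB.
    by apply: (@filterS _ (nbhs (g, c)) _ _ _ _ FB) => p Bp; exact: BA.
  apply/cvg_sup => i U [_ [[W oW <-]] /= Wi WU].
  have cv : continuous (set_val : X -> {ptws I -> nat}).
    exact: initial_continuous.
  exists ([set h | act h^-1%g i = act g^-1%g i],
    [set d : X | set_val d (act g^-1%g i) = set_val c (act g^-1%g i)]) => /=.
    split; last exact: (cv c _ (near_ptws_nat _ _)).
    exact: (invg_continuous g _ (act_open g^-1%g i)).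
  move=> [h d] [/= hg dc]; apply: WU => /=.
  by move: Wi; rewrite !valX hg dc.
exists (set_val c); first exact: set_valP.
move=> g; apply/funext => i /=.
by rewrite -[in RHS](cfix g^-1%g) valX invgK.
Qed.

(** * Open sets of automorphisms and invariant linear orders *)

Lemma near_aut_seq (L : language) (M : interpretation L nat) (g : aut M)
    (s : seq nat) : nbhs g [set h : aut M | {in s, h =1 g}].
Proof.
elim: s => [|x s IH]; first by apply: filterS filterT.
apply: filterS (filterI (near_aut g x) IH) => h [/= hx hs] y.
by rewrite inE => /predU1P[->|/hs].
Qed.

Lemma extremely_amenable_order (L : language) (M : interpretation L nat) :
  extremely_amenable (aut M) -> preserves_linear_order M.
Proof.
move=> EA.
pose act (g : aut M) (p : nat * nat) := (aut_fun g p.1, aut_fun g p.2).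
(* Colour 1 at [(x, y)] stands for x below or equal to y. The order axioms concern three points at a
   time, so a violation is visible on five pairs. *)
pose ord3 (c : nat * nat -> nat) x y z := [/\ (c (x, y) < 2)%N, c (x, x) = 1%N,
  c (x, y) = 1%N -> c (y, x) = 1%N -> x = y,
  c (x, y) = 1%N -> c (y, z) = 1%N -> c (x, z) = 1%N &
  c (x, y) = 1%N \/ c (y, x) = 1%N].
pose Y := [set c | forall x y z, ord3 c x y z].
have [|g [x y]|c|c Yc [x y]|c g Yc x y z||c Yc cinv] :=
  @ex_invariant_colouring _ _ act 2 Y EA.
- by split=> [[x y]|g h [x y]].
- apply: filterS (filterI (near_aut g x) (near_aut g y)) => h /= [hx hy].
  by rewrite /act /= hx hy.
- move=> /existsNP[x /existsNP[y /existsNP[z nc]]].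
  exists [:: (x, y); (x, x); (y, x); (y, z); (x, z)] => c' cc' Yc'; apply: nc.
  have := Yc' x y z; rewrite /ord3 !cc' // !inE eqxx ?orbT //.
- by have [] := Yc x y x.
- have [lt2 cxx anti tr tot] := Yc (aut_fun g x) (aut_fun g y) (aut_fun g z).
  split=> // cxy cyx; have [_ [gi _]] := autP g.
  by apply: gi; exact: anti.
- exists (fun p => nat_of_bool (p.1 <= p.2)%N) => x y z; split=> /=.
  + by case: (x <= y)%N.
  + by rewrite leqnn.
  + by case: leqP => // xy _; case: leqP => // yx _; apply/eqP; rewrite eqn_leq xy.
  + case: leqP => // xy _; case: leqP => // yz _.
    by rewrite (leq_trans xy yz).
  + by case: (leqP x y) => [|/ltnW ->]; [left|right].
exists (fun x y => c (x, y) == 1%N); split; last first.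
  move=> g a b /eqP cab; apply/eqP.
  by have /(congr1 (fun f => f (a, b))) := cinv g; rewrite /= /act /= cab.
split.
- by move=> x; have [_ ->] := Yc x x x.
- by move=> x y /andP[/eqP ? /eqP ?]; have [_ _ + _ _] := Yc x y x; apply.
- move=> y x z /eqP ? /eqP ?; apply/eqP.
  by have [_ _ _ + _] := Yc x y z; apply.
- by move=> x y; have [_ _ _ _ [->|->]] := Yc x y x; rewrite eqxx ?orbT.
Qed.

(** * Neighbourhoods of the identity and displaced points *)

Lemma nbhs_aut1 (L : language) (M : interpretation L nat) (V : set (aut M)) :
  nbhs (1%g : aut M) V ->
  exists N, forall g : aut M, (forall n, (n < N)%N -> g n = n) -> V g.
Proof.
(* The stabilisers of initial segments generate a filter converging pointwise to 1, so each
   neighbourhood of 1 contains one of them. *)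
pose agree N : set (aut M) := [set g : aut M | forall n, (n < N)%N -> g n = n].
pose F : set_system (aut M) := filter_from setT agree.
have FF : Filter F.
  apply: filter_from_filter; first by exists 0%N.
  move=> m n _ _; exists (maxn m n) => // g gmn.
  by split=> i ilt; apply: gmn; rewrite leq_max ilt ?orbT.
pose F' : set_system {ptws nat -> nat} := set_val @ F.
have cF : {ptws, F' --> set_val (1%g : aut M)}.
  apply/pointwise_cvgP => n A; rewrite nbhs_principalE => /principal_filterP An.
  exists n.+1 => // g /(_ n (ltnSn n)) gn.
  by rewrite /= (_ : set_val g n = n).
move=> [_ [[B oB <-] /= By BV]].
have : nbhs (set_val (1%g : aut M) : {ptws nat -> nat}) B.
  exact: open_nbhs_nbhs.
by move=> /cF[N _ NB]; exists N => g gN; apply: BV; exact: NB.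
Qed.

(** Compactness is used as near covering, for the filter of sequences directed by inclusion: any
    sequence containing [x] covers [W x]. *)
Lemma compact_ex_seq_cover (X : topologicalType) (W : X -> set X) :
  compact [set: X] -> (forall x, nbhs x (W x)) ->
  exists s : seq X, forall x, exists2 y, y \in s & W y x.
Proof.
move=> /compact_near_coveringP cX nW.
pose F : set_system (seq X) :=
  filter_from setT (fun s : seq X => [set t : seq X | {subset s <= t}]).
have FF : Filter F.
  apply: filter_from_filter; first by exists [::].
  move=> s t _ _; exists (s ++ t) => // u su.
  by split=> x xs; apply: su; rewrite mem_cat xs ?orbT.
have [|s _ sP] := cX _ F (fun s x => exists2 y, y \in s & W y x) FF.
  move=> x _; exists (W x, [set t : seq X | x \in t]) => /=.
    split; first exact: nW.
    by exists [:: x] => // t; apply; rewrite mem_head.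
  by move=> [y t] [/= Wy xt]; exists x.
by exists s => x; have [//|y] := sP s _ x I; exists y.
Qed.

(* The failure of a fixed point at [y]: the group element [g] moves the
   neighbourhood [U] of [y] off itself, and [W] is a smaller neighbourhood
   which the stabiliser of [0, ..., N - 1] keeps inside [U]. *)
Definition displaced (L : language) (M : interpretation L nat)
    (X : topologicalType) (act : aut M -> X -> X) (y : X)
    (q : aut M * nat * set X * set X) : Prop :=
  let: (g, N, U, W) := q in
  [/\ nbhs y W, forall z, U z -> ~ U (act g z) &
    forall v : aut M, (forall n, (n < N)%N -> v n = n) ->
      forall z, W z -> U (act v z)].

(** Disjoint open sets [P] around [act g y] and [Q] around [y] give [U], the points of [Q] that [g]
    sends into [P]. Continuity of the action at the identity and [y] then gives [W] and [N]. *)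
Lemma ex_displaced (L : language) (M : interpretation L nat)
    (X : topologicalType) (act : aut M -> X -> X) (y : X) :
  hausdorff_space X -> is_action act ->
  continuous (fun p : aut M * X => act p.1 p.2) ->
  (exists g, act g y <> y) ->
  exists q, displaced act y q.
Proof.
move=> + [act1 actM] cont [g /eqP gy]; rewrite open_hausdorff => haus.
have [[P Q] /= [/set_mem Pg /set_mem Qy] [oP oQ /eqP PQ]] := haus _ _ gy.
have [[V1 W1] /= [nV1 nW1] VW1] := cont (g, y) P (open_nbhs_nbhs (conj oP Pg)).
pose U : set X := Q `&` [set z | P (act g z)].
have nU : nbhs (act (1%g : aut M) y) U.
  rewrite act1; apply: filterI; first exact: open_nbhs_nbhs (conj oQ Qy).
  apply: filterS nW1 => z Wz; apply: (VW1 (g, z)).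
  by split=> //; exact: nbhs_singleton nV1.
have [[V W] /= [nV nW] VW] := cont (1%g : aut M, y) U nU.
have [N NP] := nbhs_aut1 nV.
exists (g, N, U, W); split=> //.
- move=> z [_ Pz] [Qz _].
  by have : (P `&` Q) (act g z) by []; rewrite PQ.
- by move=> v /NP Vv z Wz; exact: (VW (v, z)).
Qed.

(** * Extreme amenability and the Ramsey property *)

Section Correspondence.
Context {L : language} {K : structure L -> Prop} {le : strong_rel L}.
Arguments le : clear implicits.
Context {M : interpretation L nat}.
Hypothesis smooth : smooth_class K le.
Hypothesis M_generic : generic K le (Structure M).
Local Notation MM := (Structure M).
Implicit Types A B C : structure L.

Definition monochromatic A B (c : (A -> MM) -> nat) (l : B -> MM) : Prop :=
  forall g g' : A -> B, strong_embedding le g -> strong_embedding le g' ->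
  c (l \o g) = c (l \o g').

(** Only the values of [c] at maps [l \o g] matter, and there are finitely many maps [g] from [A] to
    [B]. *)
Lemma monochromatic_finitary A B (l : B -> MM) : K A -> K B ->
  exists s : seq (A -> MM), forall c c' : (A -> MM) -> nat, {in s, c' =1 c} ->
  monochromatic c l -> monochromatic c' l.
Proof.
move=> KA KB.
have := finite_set_fun (smooth_finite smooth KA) (smooth_finite smooth KB).
move=> /(finite_image (fun g : A -> B => (l \o g : A -> nat))).
move=> /finite_seqP[s sE]; exists s => c c' cc' cl g g' sg sg'.
have in_s (h : A -> B) : (l \o h : A -> nat) \in s.
  have : [set` s] (l \o h : A -> nat) by rewrite -sE; exists h.
  by [].
by rewrite !cc' ?in_s //; exact: cl.
Qed.

Lemma ex_bad_colouring (k : nat) (D : set MM) A B : (0 < k)%N -> finite_set D ->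
  (forall C, K C -> (exists i : B -> C, strong_embedding le i) ->
    ~ arrow le C B A k) ->
  exists c : (A -> MM) -> nat, (forall f, c f < k)%N /\
    forall l : B -> MM, generic_embedding (le := le) l ->
    range l `<=` D -> ~ monochromatic c l.
Proof.
move=> k_gt0 fD noC; have KD := finite_substructure_in M_generic fD.
have [[i si]|noi] := pselect (exists i : B -> substructure D,
    strong_embedding le i); last first.
  exists (fun=> 0%N); split=> // l gl lD; case: noi.
  have lD' b : D (l b) by apply: lD; exists b.
  by exists (corestrict lD'); exact: generic_embedding_corestrict.
have /existsNP[c /forallNP noc] := noC _ KD (ex_intro _ i si).
(* A bad colouring of the maps into the finite substructure on [D] is carried over to maps into M;
   those leaving [D] get the default colour 0. *)
pose c' (f : A -> MM) : nat :=
  if pselect (exists f' : A -> substructure D, set_val \o f' = f) is left p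
  then c (sval (cid p)) else 0%N.
have c'E (f : A -> substructure D) : c' (set_val \o f) = c f.
  rewrite /c'; case: pselect => [p|]; last by case; exists f.
  case: cid => f' /= ff'; congr (nat_of_ord (c _)); apply/funext => a.
  by apply: val_inj; have /(congr1 (fun h => h a)) := ff'.
exists c'; split=> [f|l gl lD mono]; first by rewrite /c'; case: pselect.
have lD' b : D (l b) by apply: lD; exists b.
apply: (noc (corestrict lD')); split.
  exact: generic_embedding_corestrict.
move=> g g' sg sg'; apply: val_inj => /=.
by rewrite -!c'E; exact: mono.
Qed.

Lemma extremely_amenable_ramsey :
  extremely_amenable (aut M) -> strong_ramsey K le.
Proof.
move=> EA B S k KB leS k2; apply: contrapT => noC.
pose A := substructure S; have KA : K A := smooth_sub smooth S KB.
have {}noC C : K C -> (exists i : B -> C, strong_embedding le i) ->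
    ~ arrow le C B A k.
  by move=> KC BC CBA; apply: noC; exists C.
have k0 : (0 < k)%N by exact: leq_trans k2.
pose bad (D : set MM) : set ((A -> nat) -> nat) :=
  [set c | (forall f, c f < k)%N /\
    forall l : B -> MM, generic_embedding (le := le) l ->
    range l `<=` D -> ~ monochromatic c l].
have bad_closed D : finitarily_closed (bad D).
  move=> c /not_andP[/existsNP[f /negP cf]|].
    by exists [:: f] => c' cc' [/(_ f)]; rewrite cc' ?inE // => /(negP cf).
  move=> /existsNP[l /not_implyP[gl /not_implyP[lD /contrapT mono]]].
  have [s sP] := monochromatic_finitary l KA KB.
  by exists s => c' cc' [_ /(_ l gl lD)]; apply; exact: sP cc' mono.
have [c0 c0P] : exists c, forall n, bad `I_n c.
  apply: (@ex_nested_colouring _ k) => n //.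
  - by move=> c [].
  - move=> c [ck cl]; split=> // l gl ln; apply: cl => //.
    by apply: subset_trans ln _ => x /= /ltnW.
  - by apply: ex_bad_colouring => //; exact: finite_II.
(* The range of [l] is finite, hence inside some initial segment. *)
have bad_all c : (forall n, bad `I_n c) -> bad setT c.
  move=> bc; split=> [|l gl _]; first exact: (bc 0%N).1.
  have [_ [/finite_seqP[s sE] _]] := gl.
  apply: ((bc (\max_(x <- s) x).+1).2 _ gl); rewrite sE => x /= xs.
  by rewrite ltnS (big_rem x) //= leq_maxl.
pose act (g : aut M) (f : A -> nat) : A -> nat := aut_fun g \o f.
have [|g f||c [ck _]|c g [ck cl]||c [ck cl] cinv] :=
  @ex_invariant_colouring _ _ act k (bad setT) EA.
- by split=> [f|g h f]; apply/funext.
- have /finite_seqP[s sE] := finite_range smooth (f : A -> MM) KA.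
  apply: filterS (near_aut_seq g s) => h hs; apply/funext => a; apply: hs.
  by have : [set` s] (f a) by rewrite -sE; exists a.
- exact: bad_closed.
- exact: ck.
- split=> [f|l gl _ mono]; first exact: ck.
  apply: (cl (aut_fun g \o l) _ _ mono) => //.
  exact: (generic_embedding_aut smooth M_generic).
- by exists c0; exact: bad_all.
(* By homogeneity an automorphism takes [l \o g] to [l \o g'], so the invariant colouring is
   constant on this copy of [B], against badness. *)
have [l gl] := ex_generic_embedding smooth M_generic KB.
apply: (cl l gl) => // g g' sg sg'.
have [h <-] := generic_homogeneous smooth M_generic
  (generic_embedding_comp smooth M_generic sg gl)
  (generic_embedding_comp smooth M_generic sg' gl).
by rewrite -[in LHS](cinv h).
Qed.

Lemma ramsey_extremely_amenable :
  strong_ramsey K le -> extremely_amenable (aut M).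
Proof.
move=> ramsey X act [x0 _] cX hX actX cont; apply: contrapT => nofix.
have [act1 actM] := actX.
have /choice[q qP] : forall y, exists q, displaced act y q.
  move=> y; apply: ex_displaced => //.
  by apply: contrapT => /forallNP fy; apply: nofix; exists y => g;
    apply: contrapT; exact: fy.
pose g_ y := (q y).1.1.1; pose N_ y := (q y).1.1.2.
pose U_ y := (q y).1.2; pose W_ y := (q y).2.
have {qP}qP y : [/\ nbhs y (W_ y), forall z, U_ y z -> ~ U_ y (act (g_ y) z) &
    forall v : aut M, (forall n, (n < N_ y)%N -> v n = n) ->
      forall z, W_ y z -> U_ y (act v z)].
  by have := qP y; rewrite /g_ /N_ /U_ /W_; case: (q y) => [[[? ?] ?] ?].
have [ys ysP] : exists s : seq X, forall x, exists2 y, y \in s & W_ y x.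
  by apply: compact_ex_seq_cover => // y; have [] := qP y.
pose N := \max_(y <- ys) N_ y.
have NP y : y \in ys -> (N_ y <= N)%N.
  by move=> yys; rewrite /N (big_rem y) //= leq_maxl.
(* Automorphisms that agree on [A0] differ by one fixing the first [N] points, which moves [W_ y]
   into [U_ y] for each [y] in [ys]. *)
have [A0 sA0 NA0] := ex_strong_superset smooth M_generic (finite_II N).
(* The images of [A0] under these automorphisms are the copies of [A] to be compared inside [B]. *)
pose moves : seq (aut M) := 1%g :: [seq (g_ y)^-1%g | y <- ys].
pose S : set MM := \bigcup_(f in [set` moves]) (aut_fun f @` A0).
have [|B sB SB] := ex_strong_superset smooth M_generic (_ : finite_set S).
  apply: bigcup_finite; first exact: finite_seq.
  by move=> f _; exact: finite_image sA0.1.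
have A0B : A0 `<=` B.
  by move=> a Aa; apply: SB; exists 1%g; rewrite /= ?mem_head //; exists a.
have [leA0 KB] : le (substructure B) (set_val @^-1` A0) /\ K (substructure B).
  split; last exact: (finite_substructure_in M_generic sB.1).
  by have [] := sA0.2 B sB.1 A0B.
pose A := substructure (set_val @^-1` A0 : set (substructure B)).
(* Colours are indices into [ys]; the [.+2] ensures at least two colours and the successor form that
   [inord] requires. *)
have [C [KC _ arr]] := ramsey _ _ (size ys).+2 KB leA0 isT.
have [e ge] := ex_generic_embedding smooth M_generic KC.
pose pt (a : A) : nat := set_val (set_val a).
have ptA0 a : A0 (pt a) := set_valP a.
(* If [f] is the restriction of some [h0], its colour is the index of a [y] with [act h0^-1 x0] in
   [W_ y]. By the choice of [A0], [act h^-1 x0] is then in [U_ y] for every [h] restricting to [f].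
   Other functions get colour 0. *)
have [col colP] : {col : (A -> nat) -> nat & forall f, (col f < (size ys).+2)%N /\
    forall h : aut M, aut_fun h \o pt = f ->
    nth x0 ys (col f) \in ys /\ U_ (nth x0 ys (col f)) (act h^-1%g x0)}.
  apply: (@choice _ _ (fun f i => (i < (size ys).+2)%N /\
    forall h : aut M, aut_fun h \o pt = f ->
    nth x0 ys i \in ys /\ U_ (nth x0 ys i) (act h^-1%g x0))) => f.
  have [[h0 h0f]|noh] := pselect (exists h : aut M, aut_fun h \o pt = f);
    last by exists 0%N; split=> // h hf; case: noh; exists h.
  have [y yys Wy] := ysP (act h0^-1%g x0).
  exists (index y ys); split=> [|h hf]; first by rewrite ltnS ltnW // ltnS index_size.
  rewrite nth_index //; split=> //.
  have -> : act h^-1%g x0 = act (h^-1 * h0)%g (act h0^-1%g x0).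
    by rewrite -actM mulgK.
  have [_ _] := qP y; apply=> // n nN.
  have A0n : A0 n by apply: NA0; exact: leq_trans (NP y yys).
  pose a : A := SigSub (mem_set (A0n : (set_val @^-1` A0)
    (SigSub (mem_set (A0B _ A0n)) : substructure B))).
  have : aut_fun h0 (pt a) = aut_fun h (pt a).
    by have /(congr1 (fun f => f a)) := h0f; rewrite -hf.
  rewrite /= => h0n; rewrite (_ : aut_fun _ n = aut_inv h (aut_fun h0 n)) //.
  by rewrite (h0n : aut_fun h0 n = aut_fun h n) aut_invK.
have [l [sl mono]] := arr (fun f => inord (col (e \o f))).
(* [h] agrees on [B] with the monochromatic copy [e \o l], so [h * f] restricts to
   [e \o (l \o move f)] on [A0], and all [f] in [moves] yield one colour. *)
have [h hl] := generic_homogeneous smooth M_generic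
  (generic_embedding_val sB) (generic_embedding_comp smooth M_generic sl ge).
have moveB f (fm : f \in moves) (a : A) : B (aut_fun f (pt a)).
  by apply: SB; exists f => //; exists (pt a).
pose move f fm : A -> substructure B := @corestrict L A MM B _ (moveB f fm).
have smove f (fm : f \in moves) : strong_embedding le (move f fm).
  apply: generic_embedding_corestrict sB.1 _.
  apply: (generic_embedding_aut smooth M_generic f (f := pt)).
  apply: (generic_embedding_comp smooth M_generic _ (generic_embedding_val sB)).
  by split; [exact: embedding_val|rewrite range_set_val].
pose y := nth x0 ys (col (e \o (l \o move _ (mem_head _ _)))).
have yP f (fm : f \in moves) : y \in ys /\ U_ y (act (h * f)^-1%g x0).
  have /(congr1 (@nat_of_ord _)) := mono _ _ (smove _ (mem_head _ _)) (smove f fm).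
  rewrite !inordK; [|exact: (colP _).1..] => colf; rewrite /y colf.
  apply: (colP _).2; apply/funext => a.
  exact: (congr1 (fun k => k (move f fm a)) hl).
have [yys U1] := yP _ (mem_head _ _).
have [_ Ug] : y \in ys /\ U_ y (act (h * (g_ y)^-1)^-1%g x0).
  by apply: yP; apply/orP; right; apply/mapP; exists y.
have [_ disj _] := qP y; apply: (disj _ U1).
(* The inverse of [h * (g_ y)^-1] is [g_ y * h^-1], so [g_ y] sends a point of [U_ y] back into
   [U_ y]. *)
by move: Ug; rewrite mulg1 invgM invgK actM.
Qed.

End Correspondence.

Theorem theorem2p19 (L : language) (K : structure L -> Prop)
    (le : strong_rel L) (M : interpretation L nat)
    (K_smooth : smooth_class K le) (K_hereditary : hereditary K)
    (K_amalgamation : strong_amalgamation K le)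
    (M_generic : generic K le (Structure M)) :
  extremely_amenable (aut M) <->
  preserves_linear_order M /\ strong_ramsey K le.
Proof.
split=> [EA|[_]]; last exact: ramsey_extremely_amenable.
by split; [exact: extremely_amenable_order|exact: extremely_amenable_ramsey EA].
Qed.
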